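(* Let $m\ge1$ and $1\le l\le m$. For $j\in\{l,\dots,m\}$ let $S_j=\{1,\dots,l-1\}\cup\{j\}$, and let $\mathcal R=\{S_l,\dots,S_m\}$. Define the CSS code on $n=2^m$ qubits by taking $H_X$ with $\mathrm{rs}(H_X)=\mathrm{RM}(l-1,m)$ and $H_Z$ with $\mathrm{rs}(H_Z)=\mathrm{RM}(m-l-1,m)+\mathrm{span}\{\mathrm{ev}(\hat x_S): S\subseteq[m],\ |S|=l,\ S\notin\mathcal R\}$. Then $H_XH_Z^T=0$, the code has parameters $[[2^m,\ m-l+1,\ \min(2^{m-l},2^l)]]$, and it is phantom (a CSS logical basis is given by $L_X$ with rows $\mathrm{ev}(x_{S_l}),\dots,\mathrm{ev}(x_{S_m})$ and $L_Z$ with rows $\mathrm{ev}(\hat x_{S_l}),\dots,\mathrm{ev}(\hat x_{S_m})$).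
   Context: Reed–Muller conventions: identify the $2^m$ coordinates with $\mathbb F_2^m$. For a Boolean polynomial $f\in\mathbb F_2[x_1,\dots,x_m]/(x_1^2-x_1,\dots,x_m^2-x_m)$, its evaluation vector is $\mathrm{ev}(f)=(f(a))_{a\in\mathbb F_2^m}\in\mathbb F_2^{2^m}$. $\mathrm{RM}(r,m)$ is the span of the evaluation vectors of all monomials of degree at most $r$ ($\mathrm{RM}(r,m)=\{0\}$ if $r<0$). For $S\subseteq[m]$, $x_S=\prod_{i\in S}x_i$ and its negated complement is $\hat x_S=\prod_{i\in[m]\setminus S}(1+x_i)$. CSS conventions: a CSS code is specified by $H_X,H_Z$ over $\mathbb F_2$ with $H_XH_Z^T=0$; $k=n-\operatorname{rank}H_X-\operatorname{rank}H_Z$; $d_X=\min\{|v|:v\in\ker H_Z\setminus\mathrm{rs}(H_X)\}$, $d_Z=\min\{|v|:v\in\ker H_X\setminus\mathrm{rs}(H_Z)\}$, $d=\min(d_X,d_Z)$, where $\mathrm{rs}$ is row space and $\ker M=\{v:Mv^T=0\}$. A CSS logical basis is $L_X,L_Z\in\mathbb F_2^{k\times n}$ with rows of $L_X$ in $\ker H_Z$, rows of $L_Z$ in $\ker H_X$, $L_XL_Z^T=I_k$. A permutation with matrix $P$ implements the logical CNOT circuit $A\in GL(k,\mathbb F_2)$ if $\mathrm{rs}(H_XP)=\mathrm{rs}(H_X)$, $\mathrm{rs}(H_ZP)=\mathrm{rs}(H_Z)$, rows of $L_XP-AL_X$ lie in $\mathrm{rs}(H_X)$ and rows of $L_ZP-A^{-T}L_Z$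 lie in $\mathrm{rs}(H_Z)$. The code is phantom if some CSS logical basis admits, for every ordered pair $a\ne b$ in $[k]$, a permutation implementing $I_k+E_{ab}$ ($E_{ab}$ the matrix unit). *)

(* Defs.v *)
From HB Require Import structures.
From mathcomp Require Import all_boot all_order all_algebra all_fingroup.
Set Implicit Arguments. Unset Strict Implicit. Unset Printing Implicit Defensive.
Import GRing.Theory.
Local Open Scope ring_scope.

(** Coordinates: index j : 'I_(2^m) is identified with the point a in F_2^m
    whose i-th coordinate (i : 'I_m, 0-based) is bit i of j. *)
Definition cbit (m : nat) (j : 'I_(2 ^ m)) (i : 'I_m) : bool := odd (j %/ 2 ^ i).

Definition evx (m : nat) (S : {set 'I_m}) : 'rV['F_2]_(2 ^ m) :=
  \row_(j < 2 ^ m) \prod_(i in S) ((cbit j i)%:R : 'F_2).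

Definition evxhat (m : nat) (S : {set 'I_m}) : 'rV['F_2]_(2 ^ m) :=
  \row_(j < 2 ^ m) \prod_(i in ~: S) (1 + (cbit j i)%:R : 'F_2).

(** RM(r,m) as a (square) matrix whose row space is the code;
    r is an integer, RM(r,m) = 0 for r < 0. *)
Definition RM (r : int) (m : nat) : 'M['F_2]_(2 ^ m) :=
  (\sum_(S : {set 'I_m} | (#|S|%:Z <= r)%R) <<evx S>>)%MS.

Definition wt (n : nat) (v : 'rV['F_2]_n) : nat := #|[set j | v 0 j != 0]|.

Definition in_ker (n r : nat) (M : 'M['F_2]_(r, n)) (v : 'rV['F_2]_n) : bool :=
  v *m M^T == 0.

Definition css_k (n rX rZ : nat) (HX : 'M['F_2]_(rX, n)) (HZ : 'M['F_2]_(rZ, n)) : nat :=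
  (n - \rank HX - \rank HZ)%N.

(** minimum weight of v in ker HZ \ rs(HX) (default n if the set is empty) *)
Definition css_dX (n rX rZ : nat) (HX : 'M['F_2]_(rX, n)) (HZ : 'M['F_2]_(rZ, n)) : nat :=
  \big[minn/n]_(v : 'rV['F_2]_n | in_ker HZ v && ~~ (v <= HX)%MS) wt v.

Definition css_dZ (n rX rZ : nat) (HX : 'M['F_2]_(rX, n)) (HZ : 'M['F_2]_(rZ, n)) : nat :=
  \big[minn/n]_(v : 'rV['F_2]_n | in_ker HX v && ~~ (v <= HZ)%MS) wt v.

Definition css_d (n rX rZ : nat) (HX : 'M['F_2]_(rX, n)) (HZ : 'M['F_2]_(rZ, n)) : nat :=
  minn (css_dX HX HZ) (css_dZ HX HZ).

Definition logical_basis (n rX rZ k : nat) (HX : 'M['F_2]_(rX, n)) (HZ : 'M['F_2]_(rZ, n))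
  (LX LZ : 'M['F_2]_(k, n)) : Prop :=
  [/\ LX *m HZ^T = 0, LZ *m HX^T = 0 & LX *m LZ^T = 1%:M].

(** the permutation s (matrix P = perm_mx s) implements the logical CNOT circuit A *)
Definition implements (n rX rZ k : nat) (HX : 'M['F_2]_(rX, n)) (HZ : 'M['F_2]_(rZ, n))
  (LX LZ : 'M['F_2]_(k, n)) (s : 'S_n) (A : 'M['F_2]_k) : Prop :=
  let P := perm_mx s in
  [/\ A \in unitmx,
      (HX *m P == HX)%MS, (HZ *m P == HZ)%MS,
      (LX *m P - A *m LX <= HX)%MS &
      (LZ *m P - (invmx A)^T *m LZ <= HZ)%MS].

Definition phantom_k (n rX rZ k : nat) (HX : 'M['F_2]_(rX, n)) (HZ : 'M['F_2]_(rZ, n)) : Prop :=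
  exists LX LZ : 'M['F_2]_(k, n),
    logical_basis HX HZ LX LZ /\
    forall a b : 'I_k, a != b ->
      exists s : 'S_n, implements HX HZ LX LZ s (1%:M + delta_mx a b).

Definition css_phantom (n rX rZ : nat) (HX : 'M['F_2]_(rX, n)) (HZ : 'M['F_2]_(rZ, n)) : Prop :=
  phantom_k (css_k HX HZ) HX HZ.

(** S_j = {1,...,l-1} ∪ {j}, written 0-based: j0 = j-1, {0,...,l-2} ∪ {j0} *)
Definition Sset (m l j0 : nat) : {set 'I_m} := [set i : 'I_m | (i < l.-1)%N || (i == j0 :> nat)].

Definition inR (m l : nat) (S : {set 'I_m}) : bool :=
  [exists j : 'I_m, (l.-1 <= j)%N && (S == Sset m l j)].

Definition HZspace (m l : nat) : 'M['F_2]_(2 ^ m) :=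
  (RM (m%:Z - l%:Z - 1) m +
   \sum_(S : {set 'I_m} | (#|S| == l) && ~~ inR l S) <<evxhat S>>)%MS.

(** L_X, L_Z: rows i = 0..m-l correspond to S_{l+i} *)
Definition LXmat (m l : nat) : 'M['F_2]_(m - l + 1, 2 ^ m) :=
  \matrix_(i < m - l + 1, j < 2 ^ m) evx (Sset m l (l.-1 + i)) 0 j.
Definition LZmat (m l : nat) : 'M['F_2]_(m - l + 1, 2 ^ m) :=
  \matrix_(i < m - l + 1, j < 2 ^ m) evxhat (Sset m l (l.-1 + i)) 0 j.

(* Main.v *)
(** The monomials [x_S] and the negated complements [xhat_S] are dual bases of
    F_2^(2^m), since the product of [x_S] and [xhat_T] is the indicator of the
    interval [S <= A <= T], which has odd size iff [S = T].  All spaces in play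
    are spans of subfamilies of these bases: rs(H_X) is spanned by the [x_S] with
    |S| < l, and rs(H_Z) by the [xhat_S] for which neither |S| < l nor [S] lies in
    the family R.  So kernels and ranks are read off the index families, and both
    distances follow from the minimum weight of Reed-Muller codes.  The
    transvection x_a -> x_a + x_b of the coordinates with a, b >= l permutes the
    points, preserves rs(H_X) and ker(H_Z), and acts on the rows of L_X as the
    CNOT; as it is an involution, duality gives the action on rs(H_Z) and L_Z. *)
Require Import Defs.
From HB Require Import structures.
From mathcomp Require Import all_boot all_order all_algebra all_fingroup.
From mathcomp Require Import zify.
Set Implicit Arguments. Unset Strict Implicit. Unset Printing Implicit Defensive.
Import GRing.Theory.
Local Open Scope ring_scope.

(** * Spans of subfamilies of biorthogonal families *)

Section Spans.
Context {F : fieldType} {I : finType} {n : nat}.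
Implicit Types (D : {set I}) (e f : I -> 'rV[F]_n).

Definition span_on e D : 'M[F]_n := (\sum_(i in D) <<e i>>)%MS.

Definition biorthogonal e f :=
  forall i j, e i *m (f j)^T = (i == j)%:R%:M.

(** In this form [N] can be replaced by any matrix with the same row space, or tested on spanning
    vectors. *)
Lemma mulmx_trP p q (M : 'M[F]_(p, n)) (N : 'M[F]_(q, n)) :
  reflect (M *m N^T = 0) (N <= kermx M^T)%MS.
Proof.
apply: (iffP sub_kermxP) => h; first by rewrite -[M *m _]trmxK trmx_mul trmxK h trmx0.
by rewrite -[N *m _]trmxK trmx_mul trmxK h trmx0.
Qed.

Lemma span_onP e D p (M : 'M[F]_(p, n)) :
  reflect (forall i, i \in D -> (e i <= M)%MS) (span_on e D <= M)%MS.
Proof.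
by apply: (iffP sumsmx_subP) => h i iD; move: (h i iD); rewrite genmxE.
Qed.

Lemma span_on_stable e D (P : 'M[F]_n) :
  (forall i, i \in D -> (e i *m P <= span_on e D)%MS) ->
  (span_on e D *m P <= span_on e D)%MS.
Proof.
move=> h; rewrite {1}/span_on sumsmxMr; apply/sumsmx_subP => i /h.
by rewrite (eqmxMr _ (genmxE _)).
Qed.

Lemma mem_span_on e D i : i \in D -> (e i <= span_on e D)%MS.
Proof. by move: i; apply/span_onP. Qed.

Lemma rank_span_on_le e D : (\rank (span_on e D) <= #|D|)%N.
Proof.
rewrite /span_on -sum1_card; elim/big_ind2: _ => [|x A y B hA hB|i _].
- by rewrite mxrank0.
- by apply: leq_trans (mxrank_adds_leqif _ _) _; rewrite leq_add.
- by rewrite genmxE rank_leq_row.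
Qed.

Lemma biorthogonal_sym e f : biorthogonal e f -> biorthogonal f e.
Proof.
by move=> ef i j; rewrite -[f i]trmxK -trmx_mul ef tr_scalar_mx eq_sym.
Qed.

Section Duality.
Variables (e f : I -> 'rV[F]_n).
Hypotheses (cardI : #|I| = n) (ef : biorthogonal e f).

(** Stacking both families gives [E *m G^T = 1], so [E] has rank [#|I| = n] and the [e i] form a
    basis; pairing with [f i] reads off the coefficients. *)
Lemma biorthogonal_expand (v : 'rV[F]_n) :
  v = \sum_i (v *m (f i)^T) 0 0 *: e i.
Proof.
pose E : 'M[F]_(#|I|, n) := \matrix_r e (enum_val r).
pose G : 'M[F]_(#|I|, n) := \matrix_r f (enum_val r).
have EG : E *m G^T = 1%:M.
  apply/matrixP=> r s; rewrite [RHS]mxE -(inj_eq enum_val_inj).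
  have /matrixP/(_ 0 0) := ef (enum_val r) (enum_val s); rewrite !mxE eqxx mulr1n => <-.
  by apply: eq_bigr => j _; rewrite !mxE.
have fullE : row_full E.
  rewrite /row_full -{2}cardI; apply/eqP/anti_leq; rewrite rank_leq_row /=.
  by rewrite -[X in (X <= _)%N](mxrank1 F) -EG mxrankM_maxl.
have /submxP[u ->] := submx_full v fullE.
rewrite [LHS]mulmx_sum_row (reindex (@enum_val I predT)) /=; last first.
  by apply: onW_bij; apply: enum_val_bij.
apply: eq_bigr => r _; rewrite rowK; congr (_ *: _).
have -> : (f (enum_val r))^T = col r G^T by rewrite -tr_row rowK.
by rewrite colE mulmxA -(mulmxA u) EG mulmx1 -colE mxE.
Qed.

Lemma sub_span_onP D p (M : 'M[F]_(p, n)) :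
  reflect (forall i, i \notin D -> M *m (f i)^T = 0) (M <= span_on e D)%MS.
Proof.
apply: (iffP idP) => [sMD i iD | h].
  apply/sub_kermxP/(submx_trans sMD)/span_onP => j jD; apply/sub_kermxP.
  by rewrite ef; case: eqP => [ji|_]; [rewrite -ji jD in iD | apply: raddf0].
apply/row_subP => r; rewrite [row r M]biorthogonal_expand.
rewrite summx_sub // => i _; have [iD|/h iD] := boolP (i \in D).
  exact: scalemx_sub (mem_span_on _ iD).
by rewrite -row_mul iD row0 mxE scale0r sub0mx.
Qed.

(** The spans over [D] and its complement together fill the space, so neither cardinality bound can
    be strict. *)
Lemma rank_span_on D : \rank (span_on e D) = #|D|.
Proof.
apply/anti_leq; rewrite rank_span_on_le /= -(leq_add2r #|~: D|) cardsC cardI.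
apply: leq_trans (leq_add (leqnn _) (rank_span_on_le e (~: D))).
apply: leq_trans (mxrank_adds_leqif _ _).
rewrite -[X in (X <= _)%N](mxrank1 F n) mxrankS //; apply/row_subP => r.
rewrite [row r _]biorthogonal_expand summx_sub // => i _; apply: scalemx_sub.
have [iD|iD] := boolP (i \in D).
  exact: submx_trans (mem_span_on _ iD) (addsmxSl _ _).
by apply: submx_trans (addsmxSr _ _); apply: mem_span_on; rewrite inE.
Qed.

Lemma mem_span_onE D i : (e i <= span_on e D)%MS = (i \in D).
Proof.
apply/idP/idP => [|/mem_span_on//]; apply: contraLR => iD.
apply/sub_span_onP => /(_ i iD); rewrite ef eqxx => /matrixP/(_ 0 0)/eqP.
by rewrite !mxE eqxx oner_eq0.
Qed.

(** [N] is arbitrary up to row space, because the check matrices are only known that way. *)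
Lemma ker_span_onP D p q (M : 'M[F]_(p, n)) (N : 'M[F]_(q, n)) :
  (N :=: span_on f D)%MS ->
  reflect (M *m N^T = 0) (M <= span_on e (~: D))%MS.
Proof.
move=> ND; apply: (iffP (sub_span_onP _ _)) => [h | /mulmx_trP].
  apply/mulmx_trP; rewrite ND; apply/span_onP => i iD.
  by apply/mulmx_trP/h; rewrite inE negbK.
rewrite ND => /span_onP h i; rewrite inE negbK => iD.
exact/mulmx_trP/h.
Qed.

End Duality.
End Spans.

(** * Points as subsets, subcubes and Reed-Muller codes *)

Section Points.
Context {m : nat}.
Implicit Types (S T A B U : {set 'I_m}) (j : 'I_(2 ^ m)).

(** Encoding a point by its nonzero coordinates turns the evaluation of a monomial into an inclusion
    test. *)
Definition pt j : {set 'I_m} := [set i | cbit j i].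

Lemma bits_inj k a b : (a < 2 ^ k)%N -> (b < 2 ^ k)%N ->
  (forall i, (i < k)%N -> odd (a %/ 2 ^ i) = odd (b %/ 2 ^ i)) -> a = b.
Proof.
elim: k a b => [|k IH] a b; first by rewrite expn0 !ltnS !leqn0 => /eqP-> /eqP->.
rewrite expnS => ha hb hab; rewrite -[a]odd_double_half -[b]odd_double_half.
have := hab 0 isT; rewrite expn0 !divn1 => ->; congr (_ + _.*2)%N.
apply: IH => [||i ik]; [lia | lia |].
by rewrite -!divn2 -!divnMA -expnS hab.
Qed.

Lemma card_cube_points : #|{set 'I_m}| = (2 ^ m)%N.
Proof. by rewrite -cardsT -powersetT card_powerset cardsT card_ord. Qed.

Lemma pt_bij : bijective pt.
Proof.
apply: inj_card_bij; last by rewrite card_cube_points card_ord.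
move=> j j' /setP e; apply: val_inj; apply: (bits_inj (ltn_ord j) (ltn_ord j')) => i im.
by have := e (Ordinal im); rewrite !inE.
Qed.

(* Monomials and negated complements are both indicators of subcubes
   [S <= A <= T] of the Boolean lattice. *)
Definition cube S T : 'rV['F_2]_(2 ^ m) :=
  \row_j ((S \subset pt j) && (pt j \subset T))%:R.

Lemma prod_bool (P : pred 'I_m) (b : 'I_m -> bool) :
  \prod_(i | P i) ((b i)%:R : 'F_2) = [forall i, P i ==> b i]%:R.
Proof.
case: (boolP [forall i, P i ==> b i]) => [/forall_inP h | /forall_inPn[i Pi /negPf nb]].
  by rewrite big1 // => i /h ->.
by rewrite (bigD1 i) //= nb mul0r.
Qed.

Lemma evxE S : evx S = cube S setT.
Proof.
apply/rowP => j; rewrite !mxE prod_bool subsetT andbT; congr (_%:R).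
apply: congr1; apply/forall_inP/subsetP => h i /h; by rewrite inE.
Qed.

Lemma evxhatE S : evxhat S = cube set0 S.
Proof.
apply/rowP => j; rewrite !mxE sub0set /=.
rewrite (eq_bigr (fun i => (~~ cbit j i)%:R)); last first.
  by move=> i _; case: (cbit j i) => //=; apply/eqP.
rewrite prod_bool; congr (_%:R); apply: congr1.
apply/forall_inP/subsetP => h i.
  by rewrite inE => ji; apply: contraLR ji => iS; apply: h; rewrite inE.
by rewrite inE; apply: contraNN => ji; apply: h; rewrite inE.
Qed.

(** Removing [S] identifies the interval with the powerset of [T :\: S]. *)
Lemma card_interval S T : S \subset T ->
  #|[set A : {set 'I_m} | (S \subset A) && (A \subset T)]| = (2 ^ #|T :\: S|)%N.
Proof.
move=> ST; rewrite -card_powerset -(card_in_imset (f := fun A : {set 'I_m} => A :\: S)).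
  apply: eq_card => B; rewrite [RHS]inE; apply/imsetP/idP.
    by move=> [A]; rewrite inE => /andP[_ AT] ->; apply: setSD.
  rewrite subsetD => /andP[BT BS]; exists (S :|: B).
    by rewrite inE subsetUl subUset ST.
  by rewrite setDUl setDv set0U; apply/esym/setDidPl.
move=> A B; rewrite !inE => /andP[SA _] /andP[SB _] e.
by rewrite -(setID A S) -(setID B S) e (setIidPr SA) (setIidPr SB).
Qed.

Lemma sum_pt (G : {set 'I_m} -> 'F_2) : \sum_j G (pt j) = \sum_A G A.
Proof. by rewrite [RHS](reindex pt) //; apply: onW_bij; apply: pt_bij. Qed.

Lemma natrF2 (a : nat) : (a%:R : 'F_2) = (odd a)%:R.
Proof. by apply: val_inj; rewrite /= !val_Fp_nat // modn2; case: odd. Qed.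

(** The product counts modulo 2 the interval from [S :|: S'] to [T :&: T'], whose size is zero or a
    power of two, hence odd only for a single point. *)
Lemma cube_dot S T S' T' :
  cube S T *m (cube S' T')^T = (S :|: S' == T :&: T')%:R%:M.
Proof.
apply/matrixP => i0 j0; rewrite !ord1 !mxE /= mulr1n.
pose Q A := (S :|: S' \subset A) && (A \subset T :&: T').
rewrite (eq_bigr (fun j => (Q (pt j))%:R)) => [|j _]; last first.
  by rewrite !mxE -natrM mulnb /Q subUset subsetI; congr (_%:R); do !case: (_ \subset _).
rewrite (sum_pt (fun A => (Q A)%:R)) -natr_sum -big_mkcond sum1dep_card /Q natrF2.
have [sST|nST] := boolP (S :|: S' \subset T :&: T').
  rewrite card_interval // oddX orbF cards_eq0 setD_eq0; congr (_%:R).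
  by rewrite eqEsubset sST.
rewrite (_ : [set _ | _] = set0) ?cards0.
  by case: eqP nST => // ->; rewrite subxx.
apply/setP => A; rewrite !inE; apply: contraNF nST => /andP[]; exact: subset_trans.
Qed.

Lemma monomial_duality : biorthogonal (@evx m) (@evxhat m).
Proof. by move=> S T; rewrite evxE evxhatE cube_dot setU0 setTI. Qed.

Lemma mul_evx_evx S T : evx S *m (evx T)^T = (S :|: T == setT)%:R%:M.
Proof. by rewrite !evxE cube_dot setTI. Qed.

Lemma mul_evxhat_evxhat S T : evxhat S *m (evxhat T)^T = (S :&: T == set0)%:R%:M.
Proof. by rewrite !evxhatE cube_dot setU0 eq_sym. Qed.

Lemma wt_cube S T : S \subset T -> wt (cube S T) = (2 ^ #|T :\: S|)%N.
Proof.
move=> ST; rewrite /wt -card_interval // -(card_imset _ (bij_inj pt_bij)).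
apply: eq_card => A; rewrite inE; apply/imsetP/idP => [[j]|AST].
  by rewrite inE mxE => + ->; case: (_ && _) => //; rewrite eqxx.
have [g ptK Kpt] := pt_bij; exists (g A); rewrite ?Kpt // inE mxE Kpt AST.
exact: oner_neq0.
Qed.

Lemma wt_evx S : wt (evx S) = (2 ^ (m - #|S|))%N.
Proof.
by rewrite evxE wt_cube ?subsetT // setTD; congr expn; have := cardsC S; rewrite card_ord; lia.
Qed.

Lemma wt_evxhat S : wt (evxhat S) = (2 ^ #|S|)%N.
Proof. by rewrite evxhatE wt_cube ?sub0set // setD0. Qed.

Lemma monomial_duality_sym : biorthogonal (@evxhat m) (@evx m).
Proof. exact: biorthogonal_sym monomial_duality. Qed.

(** Passage of RM(m-k-1, m) to the dual basis. Two monomials pair to zero unless their sets cover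
    all coordinates, two negated complements unless their sets are disjoint; the sizes exclude
    both. *)
Lemma RM_evxhat k :
  (span_on (@evx m) [set S : {set 'I_m} | #|S| + k < m]%N :=:
   span_on (@evxhat m) [set T : {set 'I_m} | k < #|T|]%N)%MS.
Proof.
apply/eqmxP/andP; split.
  apply/span_onP => S; rewrite inE => Sk.
  apply/(sub_span_onP card_cube_points monomial_duality_sym) => T.
  rewrite inE -leqNgt => Tk; rewrite mul_evx_evx.
  case: eqP => [/(congr1 (fun A : {set 'I_m} => #|A|))|_]; last exact: raddf0.
  by rewrite cardsT card_ord cardsU; lia.
apply/span_onP => S; rewrite inE => Sk.
apply/(sub_span_onP card_cube_points monomial_duality) => T.
rewrite inE -leqNgt => Tk; rewrite mul_evxhat_evxhat.
case: eqP => [/eqP|_]; last exact: raddf0.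
rewrite -cards_eq0 => /eqP ST0; have := cardsUI S T; have := subset_leq_card (subsetT (S :|: T)).
by rewrite ST0 cardsT card_ord; lia.
Qed.

(* For a monomial [S] of maximal degree in [v], the values of [v] on each of the
   [2 ^ (m - #|S|)] subcubes obtained by fixing the coordinates outside [S] sum
   to the coefficient of [S], so each of them meets the support of [v]. *)
Lemma RM_min_wt k (v : 'rV_(2 ^ m)) :
  (v <= span_on (@evx m) [set S : {set 'I_m} | #|S| + k <= m]%N)%MS -> v != 0 ->
  (2 ^ k <= wt v)%N.
Proof.
move=> /(sub_span_onP card_cube_points monomial_duality) vD v0.
pose c S := (v *m (evxhat S)^T) 0 0.
have vE : v = \sum_S c S *: evx S.
  exact: (biorthogonal_expand card_cube_points monomial_duality).
have [S0 cS0] : exists S, c S != 0.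
  apply/existsP; apply: contraR v0; rewrite negb_exists => /forallP c0.
  by rewrite vE big1 // => S _; move: (c0 S); rewrite negbK => /eqP->; rewrite scale0r.
have [S cS Smax] : exists2 S, c S != 0 & forall U, c U != 0 -> (#|U| <= #|S|)%N.
  by case: (@arg_maxnP _ S0 (fun S => c S != 0) (fun S => #|S|) cS0) => S; exists S.
have Sk : (#|S| + k <= m)%N.
  by apply: contraNT cS => nS; rewrite /c vD ?inE // mxE.
apply: (@leq_trans #|powerset (~: S)|).
  by rewrite card_powerset leq_exp2l //; have := cardsC S; rewrite card_ord; lia.
(* Each support point is sent to its part outside [S]; it remains to hit every [B] in the complement
   of [S], that is, every subcube. *)
apply: leq_trans (leq_imset_card (fun j => pt j :\: S) _).
apply/subset_leq_card/subsetP => B; rewrite inE => BS.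
have dBS : [disjoint S & B] by rewrite disjoint_sym disjoints_subset.
(* A monomial [U] contributes only if [U :|: B = S :|: B]; then [S \subset U], and maximality forces
   [U = S]. *)
have dual0 : (v *m (cube B (S :|: B))^T) 0 0 != 0.
  rewrite vE mulmx_suml summxE (bigD1 S) //= big1 ?addr0.
    by rewrite -scalemxAl evxE cube_dot setTI eqxx !mxE mulr1.
  move=> U US; rewrite -scalemxAl evxE cube_dot setTI mxE.
  case: (eqVneq (c U) 0) => [->|cU]; first by rewrite mul0r.
  case: eqP => [e|_]; last by rewrite raddf0 mxE mulr0.
  suff sSU : S \subset U by rewrite eq_sym eqEcard sSU Smax in US.
  apply/subsetP => i iS; have : i \in U :|: B by rewrite e inE iS.
  by rewrite inE (disjointFr dBS iS) orbF.
have [j vj jB] : exists2 j, v 0 j != 0 & (B \subset pt j) && (pt j \subset S :|: B).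
  apply/exists_inP; apply: contraR dual0 => /exists_inPn h.
  rewrite mxE big1 // => j _; rewrite !mxE.
  case: (eqVneq (v 0 j) 0) => [->|vj]; first by rewrite mul0r.
  by rewrite (negPf (h j vj)) mulr0.
apply/imsetP; exists j; rewrite ?inE //; case/andP: jB => Bj jSB.
apply/eqP; rewrite eqEsubset subsetD Bj disjoint_sym dBS /=.
by rewrite subDset.
Qed.


(** * The transvection as a permutation of the points *)

Definition flip a b A : {set 'I_m} :=
  [set i | (i \in A) (+) ((i == a) && (b \in A))].

Lemma flipK a b : a != b -> involutive (flip a b).
Proof.
move=> ab A; apply/setP => i; rewrite !inE [b == a]eq_sym (negPf ab) /= addbF.
by case: (i \in A); case: (i == a); case: (b \in A).
Qed.

(** Expansion of [(x_a + x_b) * x_(S :\ a)], with the sum in [F_2] written as an exclusive or. *)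
Lemma sub_flip a b S A : (S \subset flip a b A) =
  if a \in S then (S \subset A) (+) (b |: S :\ a \subset A) else S \subset A.
Proof.
have fixed T : a \notin T -> (T \subset flip a b A) = (T \subset A).
  move=> aT; apply/subsetP/subsetP => h i iT; have := h i iT;
    by rewrite !inE; case: eqP iT aT => [-> ->|] //=; rewrite addbF.
case: ifP => [aS|/negbT]; last exact: fixed.
rewrite -[in LHS](setD1K aS) -[in S \subset A](setD1K aS) !subUset !sub1set fixed.
  by rewrite !inE eqxx /= andb_addl.
by rewrite !inE eqxx.
Qed.

(* Substituting [x_a + x_b] for [x_a]. *)
Lemma cnot_perm a b : a != b ->
  exists s : 'S_(2 ^ m), [/\ (perm_mx s)^T = perm_mx s :> 'M['F_2]_(2 ^ m),
    perm_mx s *m perm_mx s = 1%:M :> 'M['F_2]_(2 ^ m) &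
    forall S, evx S *m perm_mx s =
      evx S + (if a \in S then evx (b |: S :\ a) else 0)].
Proof.
move=> ab; have [g ptK Kpt] := pt_bij.
pose h j := g (flip a b (pt j)).
have hK : involutive h by move=> j; rewrite /h Kpt flipK // ptK.
pose s := perm (inv_inj hK).
have sV : (s^-1 = s)%g.
  by apply/permP => j; apply: (@perm_inj _ s); rewrite permKV !permE hK.
exists s; split; first by rewrite tr_perm_mx sV.
  by rewrite -perm_mxM -{1}sV mulVg perm_mx1.
(* Right multiplication by [perm_mx s^-1] permutes columns by [s]; since [s] is its own inverse,
   this evaluates the monomial at the flipped point. *)
move=> S; apply/rowP => j; rewrite -{1}sV -col_permE !evxE !mxE permE /h Kpt !subsetT !andbT.
rewrite sub_flip; case: (a \in S); rewrite mxE ?addr0 // subsetT andbT.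
by case: (S \subset _); case: (_ \subset _) => //; apply/eqP.
Qed.

End Points.

Lemma min_wt_eq n (P : pred 'rV['F_2]_n) (w : 'rV_n) d :
  P w -> wt w = d -> (forall v, P v -> (d <= wt v)%N) ->
  \big[minn/n]_(v : 'rV_n | P v) wt v = d.
Proof.
move=> Pw wd dP; apply/anti_leq/andP; split.
  rewrite -wd.
  exact: (@Order.TotalTheory.bigmin_le_cond _ nat _ n w P (@wt n) Pw).
elim/big_ind: _ => [|x y dx dy|//]; last by rewrite leq_min dx.
(* The default value [n] is harmless, as [d] is the weight of a vector of length [n]. *)
by rewrite -wd -[X in (_ <= X)%N](card_ord n) max_card.
Qed.

(** Applying [P] once more to the inclusion gives the reverse one. *)
Lemma eqmx_involution n p (M : 'M['F_2]_(p, n)) (P : 'M_n) :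
  P *m P = 1%:M -> (M *m P <= M)%MS -> (M *m P == M)%MS.
Proof.
move=> PP sMP; rewrite sMP /=.
by rewrite -{1}[M]mulmx1 -PP mulmxA submxMr.
Qed.

Lemma addmxx_F2 p q (M : 'M['F_2]_(p, q)) : M + M = 0.
Proof. by apply/matrixP => i j; rewrite !mxE -mulr2n mulrn_pchar // pchar_Fp. Qed.

Lemma elementary_involution k (a b : 'I_k) : a != b ->
  (1%:M + delta_mx a b) *m (1%:M + delta_mx a b) = 1%:M :> 'M['F_2]_k.
Proof.
move=> ab; rewrite mulmxDl mul1mx mulmxDr mulmx1 mul_delta_mx_cond [b == a]eq_sym.
by rewrite (negPf ab) addr0 -addrA addmxx_F2 addr0.
Qed.

(** * Index families of the code and their stability *)

Section Code.
Context {m l : nat}.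
Hypotheses (l_gt0 : (0 < l)%N) (l_le_m : (l <= m)%N).
Local Notation k := (m - l + 1)%N.
Implicit Types (S : {set 'I_m}) (a b i : 'I_k).

(** In the monomial basis [low] will index rs(H_X) and [low_or_R] ker(H_Z); their difference indexes
    the logical operators. *)
Definition low : {set {set 'I_m}} := [set S : {set 'I_m} | (#|S| < l)%N].
Definition low_or_R : {set {set 'I_m}} := [set S : {set 'I_m} | (#|S| < l)%N || inR l S].
Definition Srow i : {set 'I_m} := Sset m l (l.-1 + i).

Lemma Srow_index_proof i : (l.-1 + i < m)%N.
Proof. by have := ltn_ord i; lia. Qed.

(** The variable that [Srow i] shares with no other row; the CNOTs act on these coordinates. *)
Definition Srow_index i : 'I_m := Ordinal (Srow_index_proof i).

Lemma Srow_index_in a i : (Srow_index a \in Srow i) = (a == i).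
Proof. by rewrite inE /= ltnNge leq_addr /= eqn_add2l. Qed.

Lemma Srow_inj : injective Srow.
Proof. by move=> a b eab; apply/eqP; rewrite -Srow_index_in -eab Srow_index_in. Qed.

Lemma card_Srow i : #|Srow i| = l.
Proof.
have -> : Srow i = Srow_index i |: [set j : 'I_m | (j < l.-1)%N].
  by apply/setP => j; rewrite !inE orbC -val_eqE.
rewrite cardsU1 inE ltnNge leq_addr /= -sum1dep_card.
have le1 : (l.-1 <= m)%N by lia.
by rewrite (big_ord_narrow le1) sum1_card card_ord; lia.
Qed.

(** This exchange is why the transvection adds row [b] of L_X to row [a]. *)
Lemma Srow_swap a b : Srow_index b |: Srow a :\ Srow_index a = Srow b.
Proof.
apply/setP => j; rewrite !inE -!val_eqE /=.
case: (eqVneq (nat_of_ord j) (l.-1 + b)%N) => [->|]; first by rewrite orbT.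
by case: (eqVneq (nat_of_ord j) (l.-1 + a)%N) => [->|]; rewrite ?orbF //= ltnNge leq_addr.
Qed.

Lemma inRP S : reflect (exists i, S = Srow i) (inR l S).
Proof.
apply: (iffP existsP) => [[j /andP[lj /eqP->]] | [i ->]].
  have ji : (j - l.-1 < k)%N by have := ltn_ord j; lia.
  by exists (Ordinal ji); rewrite /Srow /= subnKC.
by exists (Srow_index i); rewrite leq_addr eqxx.
Qed.

Lemma low_sub : low \subset low_or_R.
Proof. by apply/subsetP => S; rewrite !inE => ->. Qed.

Lemma Srow_notin_low i : Srow i \notin low.
Proof. by rewrite inE card_Srow ltnn. Qed.

Lemma Srow_in_low_or_R i : Srow i \in low_or_R.
Proof. by rewrite inE; apply/orP; right; apply/inRP; exists i. Qed.

Lemma card_low_or_R : #|low_or_R| = (#|low| + k)%N.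
Proof.
rewrite -(cardsID low) (setIidPr low_sub); congr addn.
rewrite -[k]card_ord -(card_imset _ Srow_inj); apply: eq_card => S.
apply/idP/imsetP => [|[i _ ->]].
  rewrite in_setD !inE => /andP[/negPf->] /= /inRP[i ->]; by exists i.
by rewrite in_setD Srow_notin_low Srow_in_low_or_R.
Qed.

Lemma RM_low : RM (l%:Z - 1) m = span_on (@evx m) low.
Proof. by apply: eq_bigl => S; rewrite inE; lia. Qed.

(** By [RM_evxhat] the Reed-Muller part supplies all sets of size above [l], none of them in the
    family R, and the extra generators supply those of size [l] outside R. *)
Lemma HZspaceE : (HZspace m l :=: span_on (@evxhat m) (~: low_or_R))%MS.
Proof.
have RMl : RM (m%:Z - l%:Z - 1) m = span_on (@evx m) [set S : {set 'I_m} | #|S| + l < m]%N.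
  by apply: eq_bigl => S; rewrite inE; lia.
have -> : HZspace m l = (span_on (@evx m) [set S : {set 'I_m} | #|S| + l < m]%N +
    span_on (@evxhat m) [set S : {set 'I_m} | (#|S| == l) && ~~ inR l S])%MS.
  by rewrite /HZspace RMl; congr (_ + _)%MS; apply: eq_bigl => S; rewrite inE.
apply/eqmxP/andP; split.
  rewrite addsmx_sub RM_evxhat; apply/andP; split; apply/span_onP => S; rewrite inE.
    move=> lS; apply: mem_span_on; rewrite !inE negb_or -leqNgt ltnW //=.
    by apply: contraTN lS => /inRP[i ->]; rewrite card_Srow ltnn.
  move=> /andP[/eqP Sl nR]; apply: mem_span_on.
  by rewrite !inE negb_or -leqNgt Sl leqnn.
apply/span_onP => S; rewrite !inE negb_or -leqNgt leq_eqVlt => /andP[/predU1P[lS|lS] nR].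
  by apply: submx_trans (addsmxSr _ _); apply: mem_span_on; rewrite inE -lS eqxx.
by apply: submx_trans (addsmxSl _ _); rewrite RM_evxhat; apply: mem_span_on; rewrite inE.
Qed.

Lemma row_LXmat i : row i (LXmat m l) = evx (Srow i).
Proof. by apply/rowP => j; rewrite !mxE. Qed.

Lemma row_LZmat i : row i (LZmat m l) = evxhat (Srow i).
Proof. by apply/rowP => j; rewrite !mxE. Qed.

Lemma LXmat_sub : (LXmat m l <= span_on (@evx m) low_or_R)%MS.
Proof. by apply/row_subP => i; rewrite row_LXmat; apply/mem_span_on/Srow_in_low_or_R. Qed.

Lemma LZmat_sub : (LZmat m l <= span_on (@evxhat m) (~: low))%MS.
Proof.
by apply/row_subP => i; rewrite row_LZmat; apply: mem_span_on; rewrite in_setC Srow_notin_low.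
Qed.

Lemma LXmat_LZmat : LXmat m l *m (LZmat m l)^T = 1%:M.
Proof.
apply/matrixP => a b.
transitivity ((row a (LXmat m l) *m (row b (LZmat m l))^T) 0 0).
  by rewrite !mxE; apply: eq_bigr => j _; rewrite !mxE.
by rewrite row_LXmat row_LZmat monomial_duality (inj_eq Srow_inj) !mxE.
Qed.

Lemma low_stable a b S : Srow_index a \in S -> S \in low ->
  Srow_index b |: S :\ Srow_index a \in low.
Proof.
rewrite !inE => aS; rewrite cardsU1 [in #|S|](cardsD1 (Srow_index a)) aS.
by apply: leq_ltn_trans; rewrite leq_add2r; case: (_ \notin _).
Qed.

(** A member of R containing [Srow_index a] must be [Srow a], which becomes [Srow b]. *)
Lemma low_or_R_stable a b S : Srow_index a \in S -> S \in low_or_R ->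
  Srow_index b |: S :\ Srow_index a \in low_or_R.
Proof.
move=> aS; rewrite [in X in X -> _]inE => /orP[Sl|/inRP[i Si]].
  by apply: (subsetP low_sub); apply: low_stable; rewrite ?inE.
move: aS; rewrite Si Srow_index_in => /eqP <-.
by rewrite Srow_swap Srow_in_low_or_R.
Qed.

Lemma cnot_stable a b (P : 'M_(2 ^ m)) (D : {set {set 'I_m}}) :
  (forall S, evx S *m P = evx S +
    (if Srow_index a \in S then evx (Srow_index b |: S :\ Srow_index a) else 0)) ->
  (forall S, Srow_index a \in S -> S \in D ->
    Srow_index b |: S :\ Srow_index a \in D) ->
  (span_on (@evx m) D *m P <= span_on (@evx m) D)%MS.
Proof.
move=> EP stD; apply: span_on_stable => S SD.
rewrite EP addmx_sub ?mem_span_on //; case: ifP => aS; last exact: sub0mx.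
exact/mem_span_on/stD.
Qed.

(** * Parameters and CNOTs for any check matrices with these row spaces *)

Section Checks.
Variables (rX rZ : nat) (HX : 'M['F_2]_(rX, 2 ^ m)) (HZ : 'M['F_2]_(rZ, 2 ^ m)).
Hypotheses (eqHX : (HX :=: span_on (@evx m) low)%MS).
Hypotheses (eqHZ : (HZ :=: span_on (@evxhat m) (~: low_or_R))%MS).

Lemma ker_HZP p (M : 'M_(p, 2 ^ m)) :
  reflect (M *m HZ^T = 0) (M <= span_on (@evx m) low_or_R)%MS.
Proof.
rewrite -[low_or_R]setCK.
exact: (ker_span_onP card_cube_points monomial_duality).
Qed.

Lemma ker_HXP p (M : 'M_(p, 2 ^ m)) :
  reflect (M *m HX^T = 0) (M <= span_on (@evxhat m) (~: low))%MS.
Proof. exact: (ker_span_onP card_cube_points monomial_duality_sym). Qed.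

Lemma css_orthogonal : HX *m HZ^T = 0.
Proof.
apply/ker_HZP; rewrite eqHX; apply/span_onP => S Sl.
exact/mem_span_on/(subsetP low_sub).
Qed.

Lemma css_dimension : css_k HX HZ = k.
Proof.
rewrite /css_k eqHX eqHZ (rank_span_on card_cube_points monomial_duality).
rewrite (rank_span_on card_cube_points monomial_duality_sym).
rewrite -[X in (X - _ - _)%N]card_cube_points -(cardsC low_or_R) card_low_or_R.
by rewrite -addnA addKn addnK.
Qed.

Let i0 : 'I_k := Ordinal (ltn_addl (m - l) (ltnSn 0)).

(** ker(H_Z) lies in RM(l, m), whose minimum weight is attained by a row of L_X. *)
Lemma css_dXE : css_dX HX HZ = (2 ^ (m - l))%N.
Proof.
apply: (@min_wt_eq _ _ (evx (Srow i0))).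
- rewrite /in_ker (introT eqP) /=; last by apply/ker_HZP/mem_span_on/Srow_in_low_or_R.
  by rewrite eqHX (mem_span_onE card_cube_points monomial_duality) Srow_notin_low.
- by rewrite wt_evx card_Srow.
move=> v /andP[/eqP/ker_HZP vD vX]; apply: RM_min_wt; last first.
  by apply: contraNneq vX => ->; apply: sub0mx.
apply: submx_trans vD _; apply/span_onP => S; rewrite inE => SD.
apply: mem_span_on; rewrite inE.
suff : (#|S| <= l)%N.   by lia.
by case/orP: SD => [/ltnW//|/inRP[i ->]]; rewrite card_Srow.
Qed.

(** ker(H_X) is spanned by the negated complements of size at least [l], which is RM(m-l, m); a row
    of L_Z attains its minimum weight. *)
Lemma css_dZE : css_dZ HX HZ = (2 ^ l)%N.
Proof.
apply: (@min_wt_eq _ _ (evxhat (Srow i0))).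
- rewrite /in_ker (introT eqP) /=.
    by rewrite eqHZ (mem_span_onE card_cube_points monomial_duality_sym) in_setC negbK Srow_in_low_or_R.
  by apply/ker_HXP/mem_span_on; rewrite in_setC Srow_notin_low.
- by rewrite wt_evxhat card_Srow.
move=> v /andP[/eqP/ker_HXP vD vZ]; apply: RM_min_wt; last first.
  by apply: contraNneq vZ => ->; apply: sub0mx.
have lowC : ~: low = [set T : {set 'I_m} | l.-1 < #|T|]%N.
  by apply/setP => T; rewrite !inE -leqNgt prednK.
apply: submx_trans vD _; rewrite lowC -RM_evxhat; apply/span_onP => S.
by rewrite inE => Sl; apply: mem_span_on; rewrite inE; lia.
Qed.

Lemma css_basis : logical_basis HX HZ (LXmat m l) (LZmat m l).
Proof.
by split; [apply/ker_HZP/LXmat_sub | apply/ker_HXP/LZmat_sub | apply: LXmat_LZmat].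
Qed.

Lemma cnot_implemented a b : a != b ->
  exists s, implements HX HZ (LXmat m l) (LZmat m l) s (1%:M + delta_mx a b).
Proof.
move=> ab; have AA := elementary_involution ab; have [uA _] := mulmx1_unit AA.
have [|s [Ps PP EP]] := @cnot_perm m (Srow_index a) (Srow_index b).
  by rewrite -val_eqE /= eqn_add2l.
exists s; rewrite /implements; set P := perm_mx s in Ps PP EP *.
set A := 1%:M + delta_mx a b in AA uA *.
have KX : (HX *m P <= HX)%MS.
  by rewrite (eqmxMr _ eqHX) eqHX; apply: cnot_stable EP _ => S; apply: low_stable.
have KZ := cnot_stable EP (@low_or_R_stable a b).
(* Equality holds exactly here, not merely modulo rs(H_X). *)
have LXP : LXmat m l *m P = A *m LXmat m l.
  apply/row_matrixP => i; rewrite row_mul row_LXmat EP Srow_index_in.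
  rewrite mulmxDl mul1mx raddfD /= row_LXmat; congr (_ + _).
  rewrite row_mul rowE mul_delta_mx_cond eq_sym; case: eqP => [->|_].
    by rewrite mulr1n -rowE row_LXmat Srow_swap.
  by rewrite mulr0n mul0mx.
have AV : invmx A = A by rewrite -[invmx A]mulmx1 -AA mulmxA mulVmx // mul1mx.
split=> //; [exact: eqmx_involution | | by rewrite LXP subrr sub0mx |].
  apply: eqmx_involution => //; rewrite eqHZ.
  (* rs(H_Z) is the annihilator of the span over [low_or_R]; as [P] is symmetric, stability of that
     span carries over. *)
  have kerP q (M : 'M_(q, 2 ^ m)) := @ker_span_onP _ _ _ _ _ card_cube_points
    monomial_duality_sym low_or_R q _ M _ (eqmx_refl _).
  apply/kerP; rewrite -[P]Ps -mulmxA -trmx_mul.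
  by apply/mulmx_trP/(submx_trans KZ)/mulmx_trP/kerP; rewrite eqHZ.
have LZLX : LZmat m l *m (LXmat m l)^T = 1%:M.
  by rewrite -[LHS]trmxK trmx_mul trmxK LXmat_LZmat trmx1.
(* Membership in rs(H_Z) is tested against the monomials of [low_or_R]. Those in R are rows of L_X,
   where [LXP] applies; those in [low] lie in rs(H_X), which is [P]-stable and orthogonal to L_Z. *)
rewrite eqHZ; apply/(sub_span_onP card_cube_points monomial_duality_sym) => S.
rewrite inE negbK inE AV => /orP[Sl | /inRP[i ->]]; last first.
  rewrite -row_LXmat; suff /(congr1 (col i)) :
      (LZmat m l *m P - A^T *m LZmat m l) *m (LXmat m l)^T = 0.
    by rewrite !colE mul0mx -mulmxA -colE -tr_row.
  rewrite mulmxBl -[A^T *m _ *m _]mulmxA LZLX mulmx1 -{1}Ps -mulmxA -trmx_mul LXP.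
  by rewrite trmx_mul mulmxA LZLX mul1mx subrr.
have SX : (evx S <= HX)%MS by rewrite eqHX mem_span_on // inE.
have LZX : LZmat m l *m HX^T = 0 by apply/ker_HXP/LZmat_sub.
apply/mulmx_trP/(submx_trans SX)/mulmx_trP.
rewrite mulmxBl -[A^T *m _ *m _]mulmxA LZX mulmx0 subr0 -Ps -mulmxA -trmx_mul.
by apply/mulmx_trP/(submx_trans KX)/mulmx_trP.
Qed.

End Checks.
End Code.

Unset Implicit Arguments.

Theorem mainTheorem12 (m l : nat) (hm : (1 <= m)%N) (hl1 : (1 <= l)%N) (hlm : (l <= m)%N)
  (rX rZ : nat) (HX : 'M['F_2]_(rX, 2 ^ m)) (HZ : 'M['F_2]_(rZ, 2 ^ m))
  (hHX : (HX == RM (l%:Z - 1) m)%MS) (hHZ : (HZ == HZspace m l)%MS) :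
  [/\ HX *m HZ^T = 0,
      css_k HX HZ = (m - l + 1)%N,
      css_d HX HZ = minn (2 ^ (m - l)) (2 ^ l),
      css_phantom HX HZ &
      logical_basis HX HZ (LXmat m l) (LZmat m l)].
Proof.
have eqHX := eqmxP hHX; rewrite RM_low // in eqHX.
have eqHZ := eqmx_trans (eqmxP hHZ) (HZspaceE hl1 hlm).
have dim := css_dimension hl1 hlm eqHX eqHZ.
have basis := css_basis hl1 hlm eqHX eqHZ.
split=> //.
- exact: (css_orthogonal eqHX eqHZ).
- by rewrite /css_d (css_dXE hl1 hlm eqHX eqHZ) (css_dZE hl1 hlm eqHX eqHZ).
(* The number of rows of the logical matrices is [css_k HX HZ], so it is rewritten before they are
   supplied. *)
rewrite /css_phantom dim; exists (LXmat m l), (LZmat m l); split=> // a b ab.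
exact: (cnot_implemented hl1 hlm eqHX eqHZ).
Qed.
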